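(* Let $\mathbb{R}$ have the standard topology, let $f:\mathbb{R}\to\mathbb{R}$ be a function, let $a\in\mathbb{R}$, and let $L\in\mathbb{A}_{f,a}$. Take the space of admissible differentials $\mathcal{D}(\mathbb{R},\mathbb{R})$ to be $\mathbb{A}_{f,a}$. Then $L$ is an abstract differential of $f$ at $a$ if and only if $L$ is a classical differential of $f$ at $a$.
   Context: A filter on a set $X$ is a nonempty collection of nonempty subsets closed under supersets and finite intersections. $C(\mathbb{R},\mathbb{R})$ denotes the continuous functions $\mathbb{R}\to\mathbb{R}$ with the continuous convergence structure: a filter $\mathcal{F}$ on it converges to $g$ iff for every $x$ and every filter $\mathcal{A}$ converging to $x$, the filter generated by the sets $F\cdot A=\{h(y):h\in F,y\in A\}$ converges to $g(x)$ (for $\mathbb{R}$ this is the compact-open topology). $\mathbb{A}_{f,a}$ is the subspace of $C(\mathbb{R},\mathbb{R})$ consisting of all affine functions $x\mapsto (x-a)p+f(a)$, $p\in\mathbb{R}$, with the induced convergence structure. Abstract differential: for convergence spaces $X,Y$, a subspace $\mathcal{D}(X,Y)$ of $C(X,Y)$, $L\in\mathcal{D}(X,Y)$, a function $f:X\to Y$ and $a\in X$, $L$ is a differential of $f$ at $a$ iff for every filter $\mathcal{A}$ converging to $a$ in $X$ there is a filter $\mathcal{L}$ on $\mathcal{D}(X,Y)$ converging to $L$ in $\mathcal{D}(X,Y)$ such that for every $K\in\mathcal{L}$ there is $A\in\mathcal{A}$ with $f(x)\in K\cdot\{x\}=\{k(x):k\in K\}$ for all $x\in A$. Classical differential: $L$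 is a classical differential of $f$ at $a$ iff $f$ is differentiable at $a$ in the usual sense and $L(h)=(h-a)f'(a)+f(a)$ for all $h$. *)

(* Defs.v *)
From mathcomp Require Import all_boot all_order all_algebra.
From mathcomp Require Import all_classical all_reals all_analysis.
Set Implicit Arguments.
Unset Strict Implicit.
Unset Printing Implicit Defensive.
Import Order.TTheory GRing.Theory Num.Theory.
Import numFieldNormedType.Exports.
Local Open Scope classical_set_scope.
Local Open Scope ring_scope.

(* [conv F x] is only meaningful when [F] is a filter, i.e. a [ProperFilter]
   (the library's [Filter] may contain the empty set). *)
Record convSpace := ConvSpace {
  conv_sort :> Type;
  conv : set_system conv_sort -> conv_sort -> Prop;
  conv_principal : forall x, conv (principal_filter x) x;
  conv_sub : forall (F G : set_system conv_sort) (x : conv_sort),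
    ProperFilter F -> ProperFilter G -> F `<=` G -> conv F x -> conv G x
}.
Arguments conv {c} F x.

Section topological_convergence.
Variable T : topologicalType.

Definition top_conv (F : set_system T) (x : T) : Prop := F --> x.

Fact top_conv_principal x : top_conv (principal_filter x) x.
Proof. by move=> A /nbhs_singleton Ax; apply/principal_filterP. Qed.

Fact top_conv_sub (F G : set_system T) (x : T) :
  ProperFilter F -> ProperFilter G -> F `<=` G -> top_conv F x -> top_conv G x.
Proof. by move=> _ _ FG Fx A /Fx /FG. Qed.

Definition topConvSpace : convSpace :=
  ConvSpace top_conv_principal top_conv_sub.

End topological_convergence.

Section subspace.
Variables (X : convSpace) (D : set X).

(* [sval @ F] is the filter on [X] generated by the members of [F]. *)
Definition sub_conv (F : set_system {x : X | D x}) (x : {x : X | D x}) : Prop :=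
  conv (sval @ F) (sval x).

Fact sub_conv_principal x : sub_conv (principal_filter x) x.
Proof.
apply: conv_sub (conv_principal (sval x)); first exact: principal_filter_proper.
  by apply: fmap_proper_filter; exact: principal_filter_proper.
by move=> A /principal_filterP Ax; apply/principal_filterP.
Qed.

Fact sub_conv_sub (F G : set_system {x : X | D x}) (x : {x : X | D x}) :
  ProperFilter F -> ProperFilter G -> F `<=` G -> sub_conv F x -> sub_conv G x.
Proof. by move=> PF PG FG; apply: conv_sub => A; exact: FG. Qed.

Definition subConvSpace : convSpace :=
  ConvSpace sub_conv_principal sub_conv_sub.

End subspace.

Section continuous_convergence.
Variables X Y : convSpace.

Definition conv_continuous (f : X -> Y) : Prop :=
  forall (x : X) (F : set_system X),
    ProperFilter F -> conv F x -> conv (f @ F) (f x).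

Definition contFun := {f : X -> Y | conv_continuous f}.

Definition dot (H : set contFun) (A : set X) : set Y :=
  [set z | exists h x, [/\ H h, A x & z = sval h x]].

(* The sets [dot H A] form a filter base, so the filter they generate consists
   of all their supersets. *)
Definition dot_filter (F : set_system contFun) (A : set_system X) :
    set_system Y :=
  filter_from [set HA : set contFun * set X | F HA.1 /\ A HA.2]
              (fun HA => dot HA.1 HA.2).

Definition cont_conv (F : set_system contFun) (g : contFun) : Prop :=
  forall (x : X) (A : set_system X),
    ProperFilter A -> conv A x -> conv (dot_filter F A) (sval g x).

Fact dot_filter_proper (F : set_system contFun) (A : set_system X) :
  ProperFilter F -> ProperFilter A -> ProperFilter (dot_filter F A).
Proof.
move=> PF PA; apply: filter_from_proper; last first.
  move=> [H B] /= [/filter_ex [h Hh] /filter_ex [x Bx]].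
  by exists (sval h x); exists h, x.
apply: filter_from_filter; first by exists (setT, setT); split; exact: filterT.
move=> [H B] [H' B'] /= [FH AB] [FH' AB'].
exists (H `&` H', B `&` B'); first by split; exact: filterI.
by move=> z [h [x [[? ?] [? ?] ->]]]; split; exists h, x.
Qed.

Fact cont_conv_principal g : cont_conv (principal_filter g) g.
Proof.
move=> x A PA Ax; apply: conv_sub (proj2_sig g x A PA Ax).
  by apply: dot_filter_proper; exact: principal_filter_proper.
move=> S /= gS; exists ([set g], sval g @^-1` S) => /=.
  by split => //; apply/principal_filterP.
by move=> z [h [y [-> Sy ->]]].
Qed.

Fact cont_conv_sub (F G : set_system contFun) (g : contFun) :
  ProperFilter F -> ProperFilter G -> F `<=` G ->
  cont_conv F g -> cont_conv G g.
Proof.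
move=> PF PG FG Fg x A PA Ax; apply: conv_sub (Fg x A PA Ax).
- exact: dot_filter_proper.
- exact: dot_filter_proper.
- by move=> S [HB [FH AB] HBS]; exists HB => //; split => //; exact: FG.
Qed.

Definition contConvSpace : convSpace :=
  @ConvSpace contFun cont_conv cont_conv_principal cont_conv_sub.

End continuous_convergence.

Definition is_abstract_differential (X Y : convSpace)
    (D : set (contConvSpace X Y)) (L : subConvSpace D) (f : X -> Y) (a : X)
    : Prop :=
  forall A : set_system X, ProperFilter A -> conv A a ->
    exists Lf : set_system (subConvSpace D),
      [/\ ProperFilter Lf, conv Lf L &
          forall K, Lf K -> exists2 B, A B &
            forall x, B x -> dot (sval @` K) [set x] (f x)].

Section affine.
Variable R : realType.

Definition affine_maps (f : R -> R) (a : R) :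
    set (contConvSpace (topConvSpace R) (topConvSpace R)) :=
  [set k | exists p : R, forall x : R, sval k x = (x - a) * p + f a].

Definition is_classical_differential (L : R -> R) (f : R -> R) (a : R) : Prop :=
  derivable f a 1 /\ forall h, L h = (h - a) * derive1 f a + f a.

End affine.

(* Main.v *)
Require Import Defs.
From mathcomp Require Import all_boot all_order all_algebra.
From mathcomp Require Import all_classical all_reals all_analysis.
From mathcomp Require Import ring lra.
Set Implicit Arguments.
Unset Strict Implicit.
Unset Printing Implicit Defensive.
Import Order.TTheory GRing.Theory Num.Theory.
Import numFieldNormedType.Exports.
Local Open Scope classical_set_scope.
Local Open Scope ring_scope.

(** Both notions say that, for every [e > 0], every value [f x] with [x] near [a]
    lies on a line through [(a, f a)] whose slope is [e]-close to the slope of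
    [L].  Convergence of affine maps through [(a, f a)] is convergence of their
    slopes: evaluating at [a + 1] recovers the slope from the map, and conversely
    [(x - a) * p + f a] is jointly continuous in [x] and [p]. *)

Section affine_differential.
Variable R : realType.
Implicit Types (f : R -> R) (a p : R).

(** For [x] other than [a] the only possible [q] is the difference quotient, so the right-hand side
    is the epsilon form of its convergence to [p]. *)
Lemma is_derive_chordP f a p :
  is_derive a 1 f p <->
  forall e, 0 < e ->
    \forall x \near a, exists2 q, `|p - q| < e & f x = (x - a) * q + f a.
Proof.
pose D h := h^-1 *: ((f \o shift a) (h *: 1) - f a).
have DE h : D h = h^-1 * (f (h + a) - f a).
  by rewrite /D /= /GRing.scale /= mulr1.
have -> : is_derive a 1 f p <-> D @ 0^' --> p.
  split=> [fp|Dp].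
    by rewrite -(@derive_val _ _ _ _ _ _ _ fp); exact: ex_derive.
  by apply: DeriveDef; [exact: cvgP Dp|exact: cvg_lim Dp].
split=> [/cvgrPdist_lt Dp e e0|chord].
  have /nbhs_ballP[d /= d0 dD] := Dp _ e0.
  apply/nbhs_ballP; exists d => //= x; rewrite /ball /= => xd.
  (* The punctured limit says nothing at [a], but there every slope fits, in particular [p]. *)
  have [->|xa] := eqVneq x a.
    by exists p; rewrite ?subrr ?normr0 // mul0r add0r.
  exists (D (x - a)).
    by apply: dD; rewrite ?subr_eq0 // /ball /= sub0r opprB.
  by rewrite DE subrK mulVKf ?subr_eq0 // subrK.
apply/cvgrPdist_lt => e e0; have /nbhs_ballP[d /= d0 dD] := chord e e0.
apply/nbhs_ballP; exists d => //= h hd h0.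
have [|q pq fE] := dD (h + a).
  by move: hd; rewrite /ball /= sub0r opprD addrC subrK.
by rewrite DE fE !addrK mulKf.
Qed.

Lemma continuous_affine_pair a b :
  continuous (fun yp : R * R => (yp.1 - a) * yp.2 + b).
Proof.
move=> yp; apply: cvgD; last exact: cvg_cst.
apply: cvgM; last exact: cvg_snd.
by apply: cvgB; [exact: cvg_fst|exact: cvg_cst].
Qed.

Lemma conv_continuous_affine a b p :
  @conv_continuous (topConvSpace R) (topConvSpace R)
    (fun x => (x - a) * p + b).
Proof.
move=> x F FF Fx; apply: cvgD; last exact: cvg_cst.
apply: cvgM; last exact: cvg_cst.
by apply: cvgB => //; exact: cvg_cst.
Qed.

Lemma affine_maps_affine f a p :
  affine_maps f a (exist _ _ (@conv_continuous_affine a (f a) p)).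
Proof. by exists p. Qed.

Definition slope_nbhs f a p (e : R) : set (subConvSpace (affine_maps f a)) :=
  [set k | exists2 q, `|p - q| < e &
    forall x, sval (sval k) x = (x - a) * q + f a].

Definition slope_filter f a p :
    set_system (subConvSpace (affine_maps f a)) :=
  filter_from [set e | 0 < e] (slope_nbhs p).

Lemma slope_filter_proper f a p : ProperFilter (@slope_filter f a p).
Proof.
apply: filter_from_proper => [|e e0].
  apply: filter_from_filter; first by exists 1 => /=.
  move=> d e /= d0 e0; exists (Num.min d e); first by rewrite /= lt_min d0 e0.
  by move=> k [q]; rewrite lt_min => /andP[qd qe] kE; split; exists q.
exists (exist _ _ (affine_maps_affine f a p)), p => //=.
by rewrite subrr normr0.
Qed.

Lemma slope_filter_conv f a p (L : subConvSpace (affine_maps f a)) :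
  (forall x, sval (sval L) x = (x - a) * p + f a) ->
  Defs.conv (slope_filter p) L.
Proof.
move=> LE x A PA Ax S; rewrite LE => xS.
(* Joint continuity at [(x, p)] separates the two constraints: [V] bounds the slopes, while [U] is a
   neighbourhood of [x] and hence in [A]. *)
have := @continuous_affine_pair a (f a) (x, p) _ xS.
case=> -[U V] /= [xU /nbhs_ballP[e /= e0 eV]] UVS.
exists (sval @` @slope_nbhs f a p e, U); first split => /=.
- by exists e => //= k ke; exists k.
- exact: Ax.
- move=> _ /= [_ [y [[k [q pq kE] <-] Uy ->]]]; rewrite kE.
  by apply: (UVS (y, q)); split => //; exact: eV.
Qed.

(** Together with [slope_filter_conv], this makes [slope_filter p] the coarsest filter converging to
    [L]. *)
Lemma conv_slope_nbhs f a p (L : subConvSpace (affine_maps f a)) Lf (e : R) :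
  (forall x, sval (sval L) x = (x - a) * p + f a) ->
  ProperFilter Lf -> Defs.conv Lf L -> 0 < e -> Lf (slope_nbhs p e).
Proof.
move=> LE PLf LfL e0.
have [] := LfL (a + 1) _ (principal_filter_proper _)
  (@conv_principal (topConvSpace R) (a + 1)) (ball (sval (sval L) (a + 1)) e).
  exact: nbhsx_ballx.
(* Since [B] contains [a + 1], where two such maps differ by exactly the difference of their slopes,
   [H] alone controls the slope. *)
move=> [H B] /= [LfH /principal_filterP Ba] HBe.
apply: filterS LfH => k Hk; case: (svalP k) => q kE; exists q => //.
have := HBe (sval (sval k) (a + 1)); rewrite /ball /= LE kE.
have -> : (a + 1 - a) * p + f a - ((a + 1 - a) * q + f a) = p - q by ring.
by apply; exists (sval k), (a + 1); split => //; rewrite kE.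
Qed.

Lemma abstract_differential_chordP f a p
    (L : subConvSpace (affine_maps f a)) :
  (forall x, sval (sval L) x = (x - a) * p + f a) ->
  is_abstract_differential L f a <->
  forall e, 0 < e ->
    \forall x \near a, exists2 q, `|p - q| < e & f x = (x - a) * q + f a.
Proof.
move=> LE; split=> [Ldiff e e0|chord A PA Aa].
  (* The coarsest filter converging to [a] is tested, so that [B] is a genuine neighbourhood of
     [a]. *)
  have [|Lf [PLf LfL /(_ (slope_nbhs p e))]] := Ldiff (nbhs a) _.
    by move=> S.
  case=> [|B aB BE]; first exact: conv_slope_nbhs LfL e0.
  apply: filterS aB => x /BE [_ [_ [[k [q pq kE] <-] -> ->]]].
  by exists q.
(* One filter serves every [A]: the chord condition holds on a neighbourhood of [a], which lies in
   [A]. *)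
exists (slope_filter p); split.
- exact: slope_filter_proper.
- exact: slope_filter_conv.
- move=> K [e /= e0 eK]; eexists; first exact: Aa (chord e e0).
  move=> x /= [q pq fE].
  pose k : subConvSpace (affine_maps f a) :=
    exist _ _ (affine_maps_affine f a q).
  exists (sval k), x; split => //.
  by exists k => //; apply: eK; exists q.
Qed.

Lemma classical_differentialP f a p (L : R -> R) :
  (forall x, L x = (x - a) * p + f a) ->
  is_classical_differential L f a <-> is_derive a 1 f p.
Proof.
move=> LE; split=> [[df dfE]|fp].
  apply: DeriveDef => //; rewrite -derive1E.
  (* At [a + 1] the two formulas for [L] reduce to their slopes plus [f a], which identifies the
     derivative with [p]. *)
  by have := dfE (a + 1); rewrite LE => ?; lra.
split; first exact: ex_derive.
by move=> h; rewrite LE derive1E derive_val.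
Qed.

End affine_differential.

Theorem theorem3p5 (R : realType) (f : R -> R) (a : R)
    (L : subConvSpace (affine_maps f a)) :
  is_abstract_differential (D := affine_maps f a) L f a <->
  is_classical_differential (sval (sval L)) f a.
Proof.
have [p LE] := svalP L.
apply: iff_trans (abstract_differential_chordP LE) _.
apply: iff_trans (iff_sym (classical_differentialP LE)).
by apply: iff_sym; exact: is_derive_chordP.
Qed.
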